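(* For every integer $s\geq 2$, there exist an integer $m\geq 1$ and a balanced bipartite graph $G[U,V]$ on $2n=2ms$ vertices such that, where $k_1$ and $k_2$ denote the unique integers with $k_1+k_2=m$ and $\delta_U=k_1s+s+r$ for an integer $r$ with $0\leq r\leq s-1$, one has $k_2\geq sk_1$ and $$\delta_U+\delta_V=n+2s-2\left\lceil\sqrt{s}\right\rceil+c(s)-1,$$ and $G$ cannot be tiled with $K_{s,s}$.
   Context: $G[U,V]$ denotes a bipartite graph with vertex classes (parts) $U$ and $V$; it is balanced if $|U|=|V|$. For such a graph, $\delta_U:=\min\{\deg(u):u\in U\}$ and $\delta_V:=\min\{\deg(v):v\in V\}$. A balanced bipartite graph $G$ on $2ms$ vertices can be tiled with $K_{s,s}$ if $G$ contains $m$ pairwise vertex-disjoint copies of the complete bipartite graph $K_{s,s}$ as (not necessarily induced) subgraphs, i.e. copies covering all vertices of $G$. The function $c:\mathbb{Z}^+\to\{0,1\}$ is defined as follows: write $s=p^2+q$ with $p,q$ the unique non-negative integers satisfying this and $0\leq q\leq 2p$. Then $c(s)=0$ if $q=0$ or $p+1\leq q\leq 2p$, and $c(s)=1$ if $1\leq q\leq p$. *)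

(* Defs.v *)
From HB Require Import structures.
From mathcomp Require Import all_boot all_order all_algebra all_field.
From mathcomp Require Import zify.

Set Implicit Arguments.
Unset Strict Implicit.
Unset Printing Implicit Defensive.

Import Order.TTheory GRing.Theory Num.Theory.

Lemma sq_decomp_ex (s : nat) :
  exists pq : nat * nat, (s == pq.1 ^ 2 + pq.2) && (pq.2 <= 2 * pq.1).
Proof.
elim: s => [|s [[p q] /= /andP[/eqP Es Hq]]]; first by exists (0, 0).
have [E|NE] := eqVneq q (2 * p); last by exists (p, q.+1) => /=; lia.
by exists (p.+1, 0) => /=; lia.
Qed.

Lemma sq_decomp_uniq (p q p' q' : nat) :
  p ^ 2 + q = p' ^ 2 + q' -> q <= 2 * p -> q' <= 2 * p' -> (p, q) = (p', q').
Proof.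
move=> E Hq Hq'; have Ep : p = p' by case: (ltngtP p p') => // H; nia.
by congr pair; lia.
Qed.

Definition sq_decomp (s : nat) : nat * nat := xchoose (sq_decomp_ex s).

Definition c (s : nat) : nat :=
  let: (p, q) := sq_decomp s in
  if (q == 0) || (p + 1 <= q <= 2 * p) then 0 else 1.

Lemma cE (p q : nat) : q <= 2 * p -> c (p ^ 2 + q) = (1 <= q <= p).
Proof.
move=> Hq; rewrite /c; have := xchooseP (sq_decomp_ex (p ^ 2 + q)).
rewrite -/(sq_decomp _); case: (sq_decomp _) => p' q' /= /andP[/eqP E Hq'].
by case: (sq_decomp_uniq E Hq Hq') => <- <-; case: ifP; lia.
Qed.

(* algR is the real closed field of real algebraic numbers. *)
Definition ceil_sqrt (s : nat) : int := Num.ceil (Num.sqrt (s%:R : algR)%R).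

Definition bipartite (T : finType) (e : rel T) (U V : {set T}) : Prop :=
  [/\ symmetric e, U :|: V = [set: T], [disjoint U & V]
    & forall x y, e x y -> (x \in U /\ y \in V) \/ (x \in V /\ y \in U)].

Lemma bipartite_irrefl (T : finType) (e : rel T) (U V : {set T}) :
  bipartite e U V -> irreflexive e.
Proof.
move=> [_ _ /pred0P dUV H] x; apply/negP => /H Hx.
by have := dUV x => /=; case: Hx => [] [-> ->].
Qed.

Definition deg (T : finType) (e : rel T) (x : T) : nat := #|[set y | e x y]|.

(* The default #|T| bounds every degree, so it is only attained spuriously
   when A is empty. *)
Definition min_deg (T : finType) (e : rel T) (A : {set T}) : nat :=
  \big[minn/#|T|]_(x in A) deg e x.

Lemma min_deg_le (T : finType) (e : rel T) (A : {set T}) (x : T) :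
  x \in A -> min_deg e A <= deg e x.
Proof.
move=> xA; have := mem_index_enum x; rewrite /min_deg.
elim: (index_enum T) => // y r IH; rewrite inE big_cons.
case/predU1P=> [<-|/IH le_r]; first by rewrite xA geq_minl.
by case: ifP => // _; rewrite geq_min le_r orbT.
Qed.

Lemma min_deg_attained (T : finType) (e : rel T) (A : {set T}) :
  A != set0 -> exists2 x, x \in A & min_deg e A = deg e x.
Proof.
case/set0Pn=> x0 x0A; exists [arg min_(x < x0 in A) deg e x].
  by case: arg_minnP.
case: arg_minnP => // x xA xmin; apply/eqP; rewrite eqn_leq min_deg_le //=.
rewrite /min_deg; elim/big_ind: _ => [|a b Ha Hb|y /xmin //].
  exact: max_card.
by rewrite leq_min Ha.
Qed.

Definition Kss (s : nat) : rel ('I_s + 'I_s)%type :=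
  fun x y => match x, y with
             | inl _, inr _ | inr _, inl _ => true
             | _, _ => false
             end.

Definition tiled (T : finType) (e : rel T) (m s : nat) : Prop :=
  exists f : 'I_m -> 'I_s + 'I_s -> T,
    [/\ forall i, injective (f i),
        forall i x y, Kss x y -> e (f i x) (f i y)
      & forall i j, i != j -> [disjoint codom (f i) & codom (f j)]].

Definition deg_params (s m dU : nat) (k1 k2 : int) : Prop :=
  (k1 + k2 = m%:Z /\
   exists r : int, dU%:Z = k1 * s%:Z + s%:Z + r /\ 0 <= r <= s%:Z - 1)%R.

Lemma deg_params_ex (s m dU : nat) :
  0 < s -> exists k1 k2 : int, deg_params s m dU k1 k2.
Proof.
move=> s0; exists ((dU %/ s)%N%:Z - 1)%R, (m%:Z - ((dU %/ s)%N%:Z - 1))%R.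
split; first by lia.
exists (dU %% s)%N%:Z%R; have := ltn_pmod dU s0; have := divn_eq dU s; split; nia.
Qed.

Lemma deg_params_uniq (s m dU : nat) (k1 k2 l1 l2 : int) :
  deg_params s m dU k1 k2 -> deg_params s m dU l1 l2 -> k1 = l1 /\ k2 = l2.
Proof.
move=> [Ek [r [Er Hr]]] [El [t [Et Ht]]].
by have E1 : k1 = l1; [nia | split=> //; lia].
Qed.

(* Main.v *)
Require Import Defs.
From mathcomp Require Import all_boot all_order all_algebra all_field.
From mathcomp Require Import zify.

Set Implicit Arguments.
Unset Strict Implicit.
Unset Printing Implicit Defensive.

Import GRing.Theory Num.Theory.

(** Two copies of [K_{s,s}] already suffice, that is m = 2 and n = 2s.  A tiling
of [G] by two copies of [K_{s,s}] two-colours the vertices so that two vertices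
in opposite parts with the same colour are adjacent; hence a non-adjacent pair
(u, v), an edge of the bipartite complement [H] of [G], gets two different
colours ([tile_complete]).  If [H] is connected, all of [V] gets one colour and
the other copy has no vertex in [V], which is absurd ([gap_not_tiled]).

It remains to choose [H] connected with the right maximum degrees.  As
2s - [min_deg] on each side is the maximum degree of [H] there, the required sum
of minimum degrees says that these maximum degrees add up to
2 ceil(sqrt s) - c(s) + 1, which is at least 4 ([hub_size_bounds]).  A path has
maximum degree 2 on both sides; we replace its beginning by a spider whose
centre is a vertex of [V] of degree d = 2 ceil(sqrt s) - c(s) - 1, which keeps
the degrees in [U] at most 2.  Finally min_deg U = 2s - 2 lies between s and
2s - 1, so that k1 = 0 and k2 = 2. *)

(** * Vertex degrees in a bipartite complement *)

Lemma min_deg_eq (T : finType) (e : rel T) (A : {set T}) (x : T) (k : nat) :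
  x \in A -> deg e x = k -> (forall y, y \in A -> k <= deg e y) ->
  min_deg e A = k.
Proof.
move=> xA dx lek; have [|y yA Ey] := @min_deg_attained _ e A.
  by apply/set0Pn; exists x.
by apply/eqP; rewrite eqn_leq -{1}dx min_deg_le // Ey lek.
Qed.

Section Ordinals.

Variable N : nat.
Implicit Types (P : pred 'I_N) (l : seq nat).

Lemma card_ord_le_size P l :
  (forall i, P i -> val i \in l) -> #|[set i | P i]| <= size l.
Proof.
move=> sPl; rewrite cardE -(size_map val); apply: uniq_leq_size.
  by rewrite (map_inj_uniq val_inj) enum_uniq.
by move=> k /mapP[i]; rewrite mem_enum inE => /sPl il ->.
Qed.

Lemma card_ord_eq_size P l : uniq l -> all (fun k => k < N) l ->
  (forall i, P i = (val i \in l)) -> #|[set i | P i]| = size l.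
Proof.
move=> Ul /allP lN PE; rewrite cardE -(size_map val).
apply/perm_size/uniq_perm => // [|k].
  by rewrite (map_inj_uniq val_inj) enum_uniq.
apply/mapP/idP => [[i]|kl]; first by rewrite mem_enum inE PE => il ->.
by exists (Ordinal (lN k kl)) => //; rewrite mem_enum inE PE.
Qed.

End Ordinals.

Definition bip_compl N (h : rel nat) : rel ('I_N + 'I_N)%type :=
  fun x y => match x, y with
             | inl i, inr j | inr j, inl i => ~~ h i j
             | _, _ => false
             end.

Definition left_part N : {set 'I_N + 'I_N} := [set inl i | i : 'I_N].
Definition right_part N : {set 'I_N + 'I_N} := [set inr i | i : 'I_N].

Section BipCompl.

Variables (N : nat) (h : rel nat).
Local Notation e := (@bip_compl N h).

Lemma mem_left_part (x : 'I_N + 'I_N) :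
  (x \in left_part N) = if x is inl _ then true else false.
Proof.
case: x => i; apply/imsetP; first by exists i.
by case.
Qed.

Lemma mem_right_part (x : 'I_N + 'I_N) :
  (x \in right_part N) = if x is inr _ then true else false.
Proof.
case: x => i; apply/imsetP; first by case.
by exists i.
Qed.

Lemma card_left_part : #|left_part N| = N.
Proof. by rewrite card_imset ?card_ord // => i j []. Qed.

Lemma card_right_part : #|right_part N| = N.
Proof. by rewrite card_imset ?card_ord // => i j []. Qed.

Lemma bip_compl_bipartite : bipartite e (left_part N) (right_part N).
Proof.
split=> [[i|i] [j|j] //||| [i|i] [j|j] //= _].
- by apply/setP=> -[i|i]; rewrite !inE mem_left_part mem_right_part.
- by apply/pred0P=> -[i|i] /=; rewrite mem_left_part mem_right_part.
- by left; rewrite mem_left_part mem_right_part.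
- by right; rewrite mem_left_part mem_right_part.
Qed.

Lemma deg_left (i : 'I_N) : deg e (inl i) = N - #|[set j : 'I_N | h i j]|.
Proof.
rewrite /deg (_ : [set y | _] = inr @: [set j : 'I_N | ~~ h i j]).
  rewrite card_imset => [|j k [] //].
  rewrite cardsCs card_ord; congr (_ - #|pred_of_set _|).
  by apply/setP=> j; rewrite !inE negbK.
apply/setP=> -[j|j]; rewrite !inE /=.
  by apply/esym/imsetP => -[].
by rewrite mem_imset ?inE // => k l [].
Qed.

Lemma deg_right (j : 'I_N) : deg e (inr j) = N - #|[set i : 'I_N | h i j]|.
Proof.
rewrite /deg (_ : [set y | _] = inl @: [set i : 'I_N | ~~ h i j]).
  rewrite card_imset => [|i k [] //].
  rewrite cardsCs card_ord; congr (_ - #|pred_of_set _|).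
  by apply/setP=> i; rewrite !inE negbK.
apply/setP=> -[i|i]; rewrite !inE /=.
  by rewrite mem_imset ?inE // => k l [].
by apply/esym/imsetP => -[].
Qed.

End BipCompl.

(** * Tilings by complete bipartite graphs *)

(** The two vertices are opposite in the tile: a vertex on the far side of a
common side would be adjacent to both and so lie in both parts. *)
Lemma tile_complete (T : finType) (e : rel T) (U V : {set T}) (s : nat)
    (f : 'I_s + 'I_s -> T) (a b : 'I_s + 'I_s) :
  bipartite e U V -> (forall x y, Kss x y -> e (f x) (f y)) ->
  f a \in U -> f b \in V -> e (f a) (f b).
Proof.
move=> [sym _ dUV eUV] fe aU bV.
have noUV x : x \in U -> x \in V -> False.
  by move=> xU xV; have := pred0P dUV x; rewrite /= xU xV.
have side_absurd z : e (f a) (f z) -> e (f b) (f z) -> False.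
  case/eUV=> -[aW zW]; case/eUV=> -[bW zW'].
  - exact: noUV bW bV.
  - exact: noUV zW' zW.
  - exact: noUV zW zW'.
  - exact: noUV aU aW.
case: a b aU bV side_absurd => [a|a] [b|b] aU bV side_absurd;
  try exact: fe.
  by case: (side_absurd (inr a)); exact: fe.
by case: (side_absurd (inl a)); exact: fe.
Qed.

Lemma tiling_covers (T : finType) (m s : nat) (f : 'I_m -> 'I_s + 'I_s -> T) :
  #|T| = m * (s + s) -> (forall i, injective (f i)) ->
  (forall i j, i != j -> [disjoint codom (f i) & codom (f j)]) ->
  forall x, exists i a, x = f i a.
Proof.
move=> cT fI dis x; pose g (z : 'I_m * ('I_s + 'I_s)) := f z.1 z.2.
have gI : injective g.
  case=> [i a] [j b]; rewrite /g /= => E.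
  have [ij|/dis/pred0P/(_ (f i a))/=] := eqVneq i j.
    by move: E; rewrite ij => /fI ->.
  by rewrite codom_f E codom_f.
have le_card : #|T| <= #|{: 'I_m * ('I_s + 'I_s)}|.
  by rewrite card_prod card_sum !card_ord cT.
have /codomP[[i a] ->] := inj_card_onto gI le_card x.
by exists i, a.
Qed.

(** With two tiles only, the two ends of a path of length two in the bipartite
complement [h] lie in the same tile, namely the one that misses its midpoint.
Such paths lead from every right vertex down to 0, so one tile takes all right
vertices and leaves none for the other. *)
Lemma gap_not_tiled (s : nat) (h : rel nat) : 0 < s ->
  (forall j, 0 < j < 2 * s -> exists i k, [/\ i < 2 * s, k < j, h i j & h i k]) ->
  ~ tiled (@bip_compl (2 * s) h) 2 s.
Proof.
move=> s0 conn [f [fI fe dis]].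
have cov : forall x, exists i a, x = f i a.
  by apply: tiling_covers => //; rewrite card_sum card_ord; lia.
have bip := bip_compl_bipartite (2 * s) h.
have gap t t' a b i j (iN : i < 2 * s) (jN : j < 2 * s) :
    h i j -> inl (Ordinal iN) = f t a -> inr (Ordinal jN) = f t' b -> t != t'.
  move=> hij fa fb; apply/eqP => E; move: fb; rewrite -E => fb.
  have := tile_complete (a := a) (b := b) bip (fe t).
  by rewrite -fa -fb mem_left_part mem_right_part /= hij => /(_ isT isT).
have N0 : 0 < 2 * s by lia.
have [t [a0 E0]] := cov (inr (Ordinal N0)).
have mono k (kN : k < 2 * s) : exists a, inr (Ordinal kN) = f t a.
  elim/ltn_ind: k kN => -[|k] IH kN.
    by exists a0; rewrite -E0; congr inr; apply: val_inj.
  have [i [l [iN lk hik hil]]] := conn k.+1 kN.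
  have [a Ea] := IH l lk (ltn_trans lk kN).
  have [t1 [b Eb]] := cov (inl (Ordinal iN)).
  have [t2 [a' Ea']] := cov (inr (Ordinal kN)).
  have t1t := gap _ _ _ _ _ _ iN _ hil Eb Ea.
  have t12 := gap _ _ _ _ _ _ iN kN hik Eb Ea'.
  have Et : t2 = t.
    by apply: val_inj; move: t1 t2 t t12 t1t {E0 IH Ea Eb Ea'}
      => [? ?] [? ?] [? ?]; rewrite -!val_eqE /=; lia.
  by exists a'; rewrite -Et.
have [t' tt'] : exists t' : 'I_2, t' != t.
  by exists (rev_ord t); rewrite -val_eqE /=; case: t {E0 mono} => ? ? /=; lia.
have in_t' (z : 'I_s + 'I_s) (j : 'I_(2 * s)) : f t' z = inr j -> False.
  case: j => j jN fz; have [a Ea] := mono j jN.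
  by have /pred0P/(_ (f t' z)) := dis _ _ tt'; rewrite /= codom_f fz Ea codom_f.
have := fe t' (inl (Ordinal s0)) (inr (Ordinal s0)) isT.
case El: (f t' (inl _)) => [i|j]; last by case: (in_t' _ _ El).
by case Er: (f t' (inr _)) => [i'|j] //; case: (in_t' _ _ Er).
Qed.

(** * The complement graph *)

(** The left vertex i subdivides the edge from i + 1 to its parent in a tree on
the right vertices; this tree is a star with centre 0 and d leaves, prolonged
by a path at its last leaf.  On left and right vertices below N > d, the left
vertex N - 1 has no i + 1 to be joined to and is pendant. *)
Definition spider (d : nat) : rel nat :=
  fun i j => (j == i.+1) || (j == if i < d then 0 else i).

Lemma spider_connected (d N j : nat) : 0 < j < N ->
  exists i k, [/\ i < N, k < j, spider d i j & spider d i k].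
Proof.
move=> jN; exists j.-1, (if j.-1 < d then 0 else j.-1); rewrite /spider eqxx orbT.
by split=> //; [lia | case: ifP; lia | apply/orP; left; lia].
Qed.

Lemma min_deg_left (d N : nat) : 0 < d -> 2 <= N ->
  min_deg (bip_compl (spider d)) (left_part N) = N - 2.
Proof.
move=> d0 N2; have N0 : 0 < N by lia.
apply: (@min_deg_eq _ _ _ (inl (Ordinal N0))) => [||[i|i]].
- by rewrite mem_left_part.
- rewrite deg_left (@card_ord_eq_size _ _ [:: 1; 0]) //=; first by lia.
  by move=> j; rewrite /spider /= d0 !inE.
- move=> _; rewrite deg_left leq_sub2l //.
  apply: (@card_ord_le_size _ _ [:: i.+1; if i < d then 0 else val i]) => j.
  by rewrite /spider !inE.
by rewrite mem_left_part.
Qed.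

Lemma min_deg_right (d N : nat) : 2 <= d <= N ->
  min_deg (bip_compl (spider d)) (right_part N) = N - d.
Proof.
move=> dN; have N0 : 0 < N by lia.
apply: (@min_deg_eq _ _ _ (inr (Ordinal N0))) => [||[j|j]].
- by rewrite mem_right_part.
- rewrite deg_right (@card_ord_eq_size _ _ (iota 0 d)) ?iota_uniq ?size_iota //.
    by apply/allP=> i; rewrite mem_iota; lia.
  by move=> i; rewrite /spider mem_iota /=; case: ifP; lia.
- by rewrite mem_right_part.
move=> _; rewrite deg_right leq_sub2l //.
have [j0|j0] := posnP (val j).
  rewrite -[leqRHS](size_iota 0); apply: card_ord_le_size => i.
  by rewrite /spider mem_iota j0 /=; case: ifP; lia.
have /leq_trans-> // : #|[set i : 'I_N | spider d i j]| <= 2; last by lia.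
apply: (@card_ord_le_size _ _ [:: j.-1; val j]) => i.
by rewrite /spider !inE /= in j0 *; case: ifP; lia.
Qed.

(** * The size of the hub *)

Lemma ceil_sqrt_eq (s k : nat) :
  k ^ 2 < s <= k.+1 ^ 2 -> ceil_sqrt s = (k.+1%:Z)%R.
Proof.
case/andP=> lo hi; have sqrE (n : nat) : (Num.sqrt (n ^ 2)%:R : algR)%R = n%:R%R.
  by rewrite natrX sqrtr_sqr ger0_norm ?ler0n.
apply: ceil_def; rewrite (_ : (_ - 1 = k%:Z)%R); last by lia.
rewrite -!pmulrn -(sqrE k) -(sqrE k.+1) ltr_sqrt ?ltr_nat ?ltr0n; last by lia.
by rewrite lo ler_sqrt ?ler_nat ?ler0n.
Qed.

(** In terms of s = p^2 + q, the value of d is 2p - 1 if q = 0, 2p if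
0 < q <= p, and 2p + 1 if p < q. *)
Lemma hub_size_bounds (s : nat) : 2 <= s -> exists d : nat,
  2 <= d <= 2 * s /\ (d%:Z = 2 * ceil_sqrt s - (c s)%:Z - 1)%R.
Proof.
move=> s2; have [[p q] /= /andP[/eqP Es qp]] := sq_decomp_ex s.
have cs := cE qp; rewrite -Es in cs; rewrite {}cs.
case: (posnP q) => [q0|q0].
  case: p => [|p] in Es qp *; first by lia.
  rewrite (@ceil_sqrt_eq s p); last by nia.
  by exists p.*2.+1; split; nia.
rewrite (@ceil_sqrt_eq s p); last by nia.
by case: (leqP q p) => ?; [exists p.*2 | exists p.*2.+1]; split; nia.
Qed.

Theorem proposition1p11 (s : nat) (hs : (2 <= s)%N) :
  exists (m : nat) (T : finType) (e : rel T) (U V : {set T}) (k1 k2 : int),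
    let n := (m * s)%N in
    let dU := min_deg e U in
    let dV := min_deg e V in
    [/\ (1 <= m)%N,
        bipartite e U V /\ (#|U| = n /\ #|V| = n),
        deg_params s m dU k1 k2 /\ (k2 >= s%:Z * k1)%R,
        (dU%:Z + dV%:Z
           = n%:Z + 2 * s%:Z - 2 * ceil_sqrt s + (c s)%:Z - 1)%R
      & ~ tiled e m s].
Proof.
have [d [dN dE]] := hub_size_bounds hs; pose N := 2 * s.
exists 2, ('I_N + 'I_N)%type, (bip_compl (spider d)), (left_part N), (right_part N).
exists 0%R, 2%R => n dU dV.
have dUE : dU = N - 2 by apply: min_deg_left; lia.
have dVE : dV = N - d by apply: min_deg_right.
split=> //.
- by rewrite card_left_part card_right_part; split=> //; apply: bip_compl_bipartite.
- by split; [split=> //; exists (s%:Z - 2)%R; lia | lia].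
- by lia.
by apply: gap_not_tiled => [|j /spider_connected]; [lia | apply].
Qed.
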